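(* For every $k\le\log m$, there exists an algorithm for $t$-restricted instances of combinatorial auctions with $m$ items and $n$ players that provides an approximation ratio of $O(k\cdot m^{\frac1{k+1}})$ in $k$ rounds, where each player sends $\mathrm{poly}(m,n)$ bits. In particular, when $k=\Theta(\log m)$ the approximation ratio is $O(\log m)$. As a corollary, there exists a $k$-round approximation algorithm for combinatorial auctions with subadditive valuations that provides an approximation ratio of $O(k\cdot m^{\frac1{k+1}}\cdot\log^3 m)$.
   Context: Combinatorial auction: a set $M$ of $m$ items and $n$ players; player $i$ has a valuation $v_i:2^M\to\mathbb{R}$ that is normalized ($v_i(\emptyset)=0$) and non-decreasing. An allocation $(A_1,\dots,A_n)$ consists of disjoint subsets of $M$; its social welfare is $\sum_i v_i(A_i)$; $OPT$ is the maximum social welfare. An algorithm has approximation ratio $c$ if it outputs an allocation of social welfare at least $OPT/c$ on every input of the class considered. A valuation $v$ is subadditive if $v(S\cup T)\le v(S)+v(T)$ for all $S,T$; additive if $v(S)=\sum_{j\in S}v(\{j\})$ for all $S$; XOS if there are additive valuations $a_1,\dots,a_q$ with $v(S)=\max_r a_r(S)$ for all $S$. An XOS valuation is binary if, for some $\mu$, $a_r(\{j\})\in\{0,\mu\}$ for every $a_r$ and every item $j$. An instance with binary XOS valuations (all with the same $\mu$, without loss of generality $\mu=1$) is $t$-restricted if there is an allocation $(A_1,\dots,A_n)$ such that: (1) $v_i(A_i)=|A_i|$ for every $i$; (2) for every $i$, either $|A_i|=t$ or $|A_i|=0$; (3) $t$ is a power of $2$; (4) $\sum_i v_i(A_i)\ge\frac{OPT}{2\log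 m}$. In a $k$-round algorithm, in each of $k$ rounds every player writes a message on a common blackboard; the message may depend on his own valuation and on the messages of all players in previous rounds. The output allocation is determined by the contents of the blackboard after the last round. *)

(* Defs.v *)
From HB Require Import structures.
From mathcomp Require Import all_boot all_order all_algebra.
From mathcomp Require Import all_classical all_reals all_analysis.

Set Implicit Arguments.
Unset Strict Implicit.
Unset Printing Implicit Defensive.

Import Order.TTheory GRing.Theory Num.Theory.
Local Open Scope ring_scope.

Definition log2 (R : realType) (x : R) : R := ln x / ln 2%:R.

(** * Valuations *)

Definition valuation (R : realType) (m : nat) := {set 'I_m} -> R.

Definition is_valuation (R : realType) (m : nat) (v : valuation R m) : Prop :=
  v finset.set0 = 0 /\ forall S T : {set 'I_m}, S \subset T -> v S <= v T.

Definition subadditive (R : realType) (m : nat) (v : valuation R m) : Prop :=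
  forall S T : {set 'I_m}, v (S :|: T) <= v S + v T.

Definition additive_valuation (R : realType) (m : nat) (v : valuation R m)
    : Prop :=
  is_valuation v /\ forall S : {set 'I_m}, v S = \sum_(j in S) v [set j]%SET.

(* There is at least one clause and clauses are nonnegative, so the default
   value 0 of the iterated maximum plays no role. *)
Definition xos_by (R : realType) (m q : nat) (a : 'I_q.+1 -> valuation R m)
    (v : valuation R m) : Prop :=
  (forall r, additive_valuation (a r)) /\
  forall S : {set 'I_m}, v S = \big[Num.max/0]_r a r S.

Definition binary_xos (R : realType) (m : nat) (mu : R) (v : valuation R m)
    : Prop :=
  exists (q : nat) (a : 'I_q.+1 -> valuation R m),
    xos_by a v /\ forall r j, a r [set j]%SET = 0 \/ a r [set j]%SET = mu.

(** * Allocations *)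

Definition profile (R : realType) (m n : nat) := 'I_n -> valuation R m.

Definition bundles (m n : nat) := {ffun 'I_n -> {set 'I_m}}.

Definition is_allocation (m n : nat) (A : bundles m n) : bool :=
  [forall i, forall j, (i != j) ==> [disjoint A i & A j]].

Definition welfare (R : realType) (m n : nat) (v : profile R m n)
    (A : bundles m n) : R :=
  \sum_i v i (A i).

(* Valuations are nonnegative, and the empty allocation has welfare 0, so the
   default value 0 of the iterated maximum plays no role. *)
Definition OPT (R : realType) (m n : nat) (v : profile R m n) : R :=
  \big[Num.max/0]_(A : bundles m n | is_allocation A) welfare v A.

Definition t_restricted (R : realType) (m n t : nat) (v : profile R m n)
    : Prop :=
  (forall i, binary_xos 1 (v i)) /\
  exists A : bundles m n, is_allocation A /\
    [/\ forall i, v i (A i) = #|A i|%:R,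
        forall i, #|A i| = t \/ #|A i| = 0%N,
        exists e : nat, t = (2 ^ e)%N
      & OPT v / (2%:R * log2 m%:R) <= welfare v A].

Definition subadditive_instance (R : realType) (m n : nat) (v : profile R m n)
    : Prop :=
  forall i, is_valuation (v i) /\ subadditive (v i).

(* No bound in terms of m and n alone can hold for the communication needed on
   arbitrary real valuations: already for two players competing for one item,
   the orders of magnitude of the two values must be compared.  The parameter
   b measures that order of magnitude. *)
Definition magnitude_le (R : realType) (m n b : nat) (v : profile R m n)
    : Prop :=
  forall i S, v i S = 0 \/ 2%:R ^- b <= v i S <= 2%:R ^+ b.

(** * Blackboard algorithms *)

(* The entry of a blackboard at index r is the family of messages (bit strings)
   written simultaneously by the players in round r. *)
Definition blackboard (n : nat) := seq {ffun 'I_n -> seq bool}.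

(* The players see the messages of all previous rounds; in particular they know
   the index of the current round, which is the size of the blackboard. *)
Record algorithm (R : realType) (m n : nat) := Algorithm {
  message : 'I_n -> valuation R m -> blackboard n -> seq bool;
  output : blackboard n -> bundles m n
}.

Fixpoint run (R : realType) (m n : nat) (P : algorithm R m n)
    (v : profile R m n) (k : nat) : blackboard n :=
  if k is r.+1 then
    let h := run P v r in rcons h [ffun i => message P i (v i) h]
  else [::].

Definition bits_sent (R : realType) (m n : nat) (P : algorithm R m n)
    (v : profile R m n) (k : nat) (i : 'I_n) : nat :=
  (\sum_(h <- run P v k) size (h i))%N.

Definition approximates (R : realType) (m n : nat) (P : algorithm R m n)
    (k : nat) (instances : profile R m n -> Prop) (c : R) : Prop :=
  forall v, instances v ->
    let A := output P (run P v k) in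
    is_allocation A /\ OPT v / c <= welfare v A.

(* Main.v *)
Require Import Defs.
From HB Require Import structures.
From mathcomp Require Import all_boot all_order all_algebra.
From mathcomp Require Import all_classical all_reals all_analysis.
From mathcomp Require Import fintype finset zify ring lra.

Set Implicit Arguments.
Unset Strict Implicit.
Unset Printing Implicit Defensive.

Import Order.TTheory GRing.Theory Num.Theory.
Local Open Scope ring_scope.

(* Call a bundle dense at density mu for a player if each of its subsets T has
   value at least mu |T|; dense bundles form a downward closed family.

   Fix a density.  For every bundle size s, each player keeps a universe of
   items and reports in every round a maximal family of disjoint dense bundles
   of size s inside it.  The blackboard then reassigns greedily: a player
   receives the untaken part of one of his reported bundles whenever this more
   than doubles what he holds.  Items that were ever taken stay taken, so there
   are at most twice as many of them as are held in the end.  The next universe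
   is the untaken part of the reported bundles.  If a player ends with c items,
   every reported bundle has at most 2c untaken items, so for s = 2cB each round
   shrinks his universe by a factor B; with B^(k+1) >= m at most B items are
   left after k rounds.  By maximality, a dense bundle A loses fewer than s
   items per round except by their being taken, so |A| <= 3kBc + |A meet taken|.
   Summing over the bundles of an allocation gives a fraction 1/(5kB) of its
   size.

   An optimal allocation for binary XOS valuations may be taken to consist of
   bundles that are dense at density 1.  For subadditive valuations, all
   densities 2^j are run in parallel.  Peeling off a largest subset T of value
   at most mu |T| leaves a dense bundle; peeling at doubling densities, starting
   from OPT / 2m, bounds OPT by a sum of O(log m) sizes of dense allocations,
   each weighted by its density. *)

(** * Greedy reassignment of reported bundles *)

Section Packing.
Local Open Scope nat_scope.
Local Open Scope set_scope.
Variable m : nat.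
Implicit Types (F : pred {set 'I_m}) (U : {set 'I_m}) (P : {set {set 'I_m}}).

Definition packing F U s P :=
  trivIset P && [forall b in P, [&& b \subset U, #|b| == s & F b]].

Definition max_packing F U s := [arg max_(P > set0 | packing F U s P) #|P|].

Lemma packing0 F U s : packing F U s set0.
Proof.
apply/andP; split; first by apply/trivIsetP => A B; rewrite inE.
by apply/forall_inP => b; rewrite inE.
Qed.

Lemma max_packingP F U s : packing F U s (max_packing F U s).
Proof.
rewrite /max_packing; case: arg_maxnP => //.
exact: packing0.
Qed.

Lemma packing_mem F U s P b : packing F U s P -> b \in P ->
  [/\ b \subset U, #|b| = s & F b].
Proof.
by case/andP => _ /forall_inP h /h /and3P[? /eqP ? ?].
Qed.

Lemma cover_packing F U s P : packing F U s P -> cover P \subset U.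
Proof.
by move=> hP; apply/bigcupsP => b /(packing_mem hP)[].
Qed.

Lemma card_cover_packing F U s P : packing F U s P -> #|cover P| = #|P| * s.
Proof.
move=> hP; have /andP[/eqP <- _] := hP.
rewrite -sum_nat_const; apply: eq_bigr => b bP.
by have [] := packing_mem hP bP.
Qed.

Lemma card_coverD_le P (H : {set 'I_m}) q :
  (forall b, b \in P -> #|b :\: H| <= q) -> #|cover P :\: H| <= #|P| * q.
Proof.
move=> h; rewrite -sum_nat_const.
apply: (@leq_trans (\sum_(b in P) #|b :\: H|)); last exact: leq_sum.
have -> : cover P :\: H = \bigcup_(b in P) (b :\: H).
  apply/setP => x; rewrite inE; apply/idP/idP.
    case/andP => xH /bigcupP[b bP xb]; apply/bigcupP; exists b => //.
    by rewrite inE xH.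
  case/bigcupP => b bP; rewrite inE => /andP[-> xb] /=.
  by apply/bigcupP; exists b.
elim/big_rec2: _ => [|b y X _ le]; first by rewrite cards0.
by apply: leq_trans (leq_card_setU _ _) _; rewrite leq_add2l.
Qed.

(** Otherwise [s] items of [X] would form another admissible bundle, disjoint from the packing, and
    could be added to it. *)
Lemma max_packing_residue F U s (X : {set 'I_m}) :
  0 < s -> (forall b c : {set 'I_m}, F b -> c \subset b -> F c) -> F X ->
  X \subset U :\: cover (max_packing F U s) -> #|X| < s.
Proof.
move=> s0 Fdown FX XU; rewrite ltnNge; apply/negP => sX.
have [Y YX cY] : exists2 Y : {set 'I_m}, Y \subset X & #|Y| = s.
  have := sX; rewrite -bin_gt0 -(cards_draws X s) card_gt0 => /set0Pn[Y].
  by rewrite inE => /andP[YX /eqP cY]; exists Y.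
have {X FX XU sX YX} [FY YU] : F Y /\ Y \subset U :\: cover (max_packing F U s).
  by split; [exact: Fdown FX YX | exact: subset_trans YX XU].
move: YU; rewrite /max_packing; case: arg_maxnP; last move=> P hP maxP.
  exact: packing0.
rewrite subsetD => /andP[YU dY].
have YP : Y \notin P.
  apply/negP => YP; have /set0Pn[y yY] : Y != set0 by rewrite -card_gt0 cY.
  have /pred0P/(_ y) /= := dY; rewrite yY /= => /negP[].
  by apply/bigcupP; exists Y.
have : packing F U s (Y |: P).
  have /andP[tP _] := hP; apply/andP; split.
    apply/trivIsetP => A B /setU1P[->|AP] /setU1P[->|BP] // nAB.
    - by rewrite eqxx in nAB.
    - by apply: disjointWr dY; exact: bigcup_sup BP.
    - by rewrite disjoint_sym; apply: disjointWr dY; exact: bigcup_sup AP.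
    - by move/trivIsetP: tP; apply.
  apply/forall_inP => b /setU1P[->|bP]; first by rewrite YU cY eqxx FY.
  by have [-> -> ->] := packing_mem hP bP; rewrite eqxx.
by move/maxP => /=; rewrite cardsU1 YP add1n ltnn.
Qed.

End Packing.

Section Greedy.
Local Open Scope nat_scope.
Local Open Scope set_scope.
Variables m n : nat.

Definition reports := 'I_n -> 'I_m -> {set {set 'I_m}}.

(* The second component is the set of items that have ever been held. *)
Definition holding := (bundles m n * {set 'I_m})%type.

Definition volume (C : bundles m n) : nat := \sum_i #|C i|.

(* Every change at least doubles the bundle of a player, hence the factor 2. *)
Definition balanced (st : holding) :=
  [&& is_allocation st.1, [forall i, st.1 i \subset st.2]
    & #|st.2| <= 2 * volume st.1].

(** Records what a chain of reassignments preserves, so that no order of them has to be fixed. *)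
Definition extends (st : holding) (D : reports) (st' : holding) :=
  [&& balanced st', st.2 \subset st'.2,
      [forall i, #|st.1 i| <= #|st'.1 i|]
    & [forall i, (st'.1 i == st.1 i) ||
                 [exists s, [exists b in D i s, st'.1 i \subset b]]]].

(* At a maximum no reassignment that more than doubles a bundle is left, as at
   the end of the greedy process. *)
Definition greedy (st : holding) (D : reports) : holding :=
  [arg max_(st' > st | extends st D st') volume st'.1].

Lemma extends_refl st D : balanced st -> extends st D st.
Proof.
move=> bst; rewrite /extends bst subxx /=; apply/andP; split.
  by apply/forallP => i.
by apply/forallP => i; rewrite eqxx.
Qed.

Lemma greedyP st D : balanced st -> extends st D (greedy st D) /\
  forall st', extends st D st' -> volume st'.1 <= volume (greedy st D).1.
Proof.
move=> bst; rewrite /greedy; case: arg_maxnP => //; exact: extends_refl.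
Qed.

Lemma greedy_extends st D : balanced st -> extends st D (greedy st D).
Proof. by case/(greedyP D). Qed.

Lemma greedy_maximal st (D : reports) i s b : balanced st -> b \in D i s ->
  #|b :\: (greedy st D).2| <= 2 * #|(greedy st D).1 i|.
Proof.
move=> bst bD; have [] := greedyP D bst.
case: (greedy st D) => C H /= ext maxC; rewrite leqNgt; apply/negP => lt.
set X := b :\: H in lt.
pose C' : bundles m n := [ffun j => if j == i then X else C j].
have volC' : volume C' + #|C i| = volume C + #|X|.
  rewrite /volume (bigD1 i) //= [in RHS](bigD1 i) //= ffunE eqxx.
  rewrite (eq_bigr (fun j => #|C j|)).
    by rewrite addnAC [#|X| + _]addnC addnAC.
  by move=> j /negPf ji; rewrite ffunE ji.
case/and4P: ext => /and3P[/= allC subC cH] subH /forallP geC /forallP fromD.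
have {}subC j : C j \subset H by exact: (forallP subC).
have disjX j : [disjoint X & C j].
  rewrite disjoint_sym; apply: disjointWl (subC j) _.
  by rewrite disjoint_sym disjoints_subset subsetDr.
have /maxC /= : extends st D (C', H :|: X).
  apply/and4P; split => /=; last 2 first.
  - apply/forallP => j; rewrite ffunE.
    case: (j =P i) => [->|_]; last exact: geC.
    by have := geC i => /= le; lia.
  - apply/forallP => j; rewrite ffunE.
    case: (j =P i) => [->|_]; last exact: fromD.
    apply/orP; right; apply/existsP; exists s; apply/existsP; exists b.
    by rewrite bD subsetDl.
  - apply/and3P; split => /=.
    + apply/forallP => j; apply/forallP => l; apply/implyP => jl.
      rewrite !ffunE; case: (j =P i) => [ji|_]; case: (l =P i) => [li|_].
      * by rewrite ji li eqxx in jl.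
      * exact: disjX.
      * by rewrite disjoint_sym.
      * by have /forallP/(_ j)/forallP/(_ l)/implyP := allC; apply.
    + apply/forallP => j; rewrite ffunE.
      case: (j =P i) => _; first exact: subsetUr.
      exact: subset_trans (subC j) (subsetUl _ _).
    (* The volume grows by [#|X| - #|C i|], which is more than half of the [#|X|] newly taken
       items. *)
    + apply: leq_trans (leq_card_setU H X) _.
      move: lt volC' cH; set x := #|X|; set c := #|C i|; set h := #|H|.
      by lia.
  - exact: subset_trans subH (subsetUl _ _).
by move: lt volC'; set x := #|X|; set c := #|C i|; lia.
Qed.

(* Universe [i s] is the set of items in which player [i] looks for bundles of
   size [s.+1]. *)
Definition state := (holding * ('I_n -> 'I_m -> {set 'I_m}))%type.

Definition start : state := (([ffun=> set0], set0), fun _ _ => setT).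

Definition advance (st : state) (D : reports) : state :=
  let h := greedy st.1 D in (h, fun i s => cover (D i s) :\: h.2).

Variable F : 'I_n -> pred {set 'I_m}.
Hypothesis F0 : forall i, F i set0.
Hypothesis Fdown : forall i (b c : {set 'I_m}), F i b -> c \subset b -> F i c.

Definition packings (st : state) : reports :=
  fun i s => max_packing (F i) (st.2 i s) s.+1.

Definition after (r : nat) : state :=
  iter r (fun st => advance st (packings st)) start.

Definition held r i := (after r).1.1 i.
Definition taken r := (after r).1.2.
Definition universe r i s := (after r).2 i s.

Lemma after_balanced r : balanced (after r).1.
Proof.
elim: r => [|r IH]; last first.
  by have /and4P[] := greedy_extends (packings (after r)) IH.
apply/and3P; split => /=; last by rewrite cards0.
- apply/forallP => i; apply/forallP => j; apply/implyP => _.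
  by rewrite !ffunE -setI_eq0 setI0.
- by apply/forallP => i; rewrite ffunE sub0set.
Qed.

Lemma heldS r i : #|held r i| <= #|held r.+1 i|.
Proof.
have /and4P[_ _ /forallP h _] :=
  greedy_extends (packings (after r)) (after_balanced r).
exact: h.
Qed.

Lemma held_mono r r' i : r <= r' -> #|held r i| <= #|held r' i|.
Proof.
move/subnK <-; elim: (r' - r) => // d IH.
exact: leq_trans IH (heldS _ _).
Qed.

Lemma takenS r : taken r \subset taken r.+1.
Proof.
by have /and4P[] := greedy_extends (packings (after r)) (after_balanced r).
Qed.

Lemma heldF r i : F i (held r i).
Proof.
elim: r => [|r IH]; first by rewrite /held /= ffunE.
have /and4P[_ _ _ /forallP/(_ i)/orP[/eqP e|]] :=
  greedy_extends (packings (after r)) (after_balanced r).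
  by rewrite /held /= e.
case/existsP => s /existsP[b /andP[bD sub]].
have [_ _ Fb] := packing_mem (max_packingP _ _ _) bD.
exact: Fdown Fb sub.
Qed.

(** Each reported bundle of [s.+1] items keeps at most twice the current holding. Holdings only
    grow, so the one after round [k] bounds the earlier ones. *)
Lemma card_universe k r i (s : 'I_m) B :
  r <= k -> 2 * #|held k i| * B <= s.+1 ->
  #|universe r i s| * B ^ r <= m.
Proof.
move=> rk le; elim: r rk => [|r IH] rk.
  by rewrite muln1 cardsT card_ord.
apply: leq_trans (IH (ltnW rk)).
rewrite expnS mulnA leq_mul2r; apply/orP; right.
set P := packings (after r) i s.
have hP : packing (F i) (universe r i s) s.+1 P by exact: max_packingP.
apply: leq_trans (subset_leq_card (cover_packing hP)).
rewrite (card_cover_packing hP).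
apply: (@leq_trans (#|P| * (2 * #|held k i|) * B)).
  rewrite leq_mul2r; apply/orP; right.
  apply: card_coverD_le => b bP.
  apply: leq_trans (greedy_maximal (after_balanced r) bP) _.
  by rewrite leq_mul2l; apply/orP; right; exact: (@held_mono r.+1 k i rk).
by rewrite -mulnA leq_mul2l le orbT.
Qed.

(** The items of [A] lost in a round without being taken are left uncovered by a maximal packing
    with bundles of size [s.+1], so there are at most [s] of them. *)
Lemma card_lost r i (s : 'I_m) (A : {set 'I_m}) : F i A ->
  #|A :\: (universe r i s :|: taken r)| <= r * s.
Proof.
move=> FA; elim: r => [|r IH].
  by rewrite setTU setDT cards0.
rewrite mulSn addnC.
set P := packings (after r) i s.
pose L := A :&: (universe r i s :\: cover P).
have cL : #|L| <= s.
  rewrite -ltnS; apply: max_packing_residue (Fdown FA (subsetIl _ _)) _ => //.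
    exact: Fdown.
  exact: subsetIr.
apply: leq_trans (leq_add IH cL).
apply: leq_trans (leq_card_setU _ _).
apply: subset_leq_card; apply/subsetP => x.
have := subsetP (takenS r) x.
rewrite /universe /taken /= !inE -/P.
case: (x \in A); rewrite ?andbF //= !andbT.
case: (x \in cover P); case: (x \in (after r).2 i s);
  case: (x \in (after r).1.2); case: (x \in (greedy _ _).2) => //=.
Qed.

Lemma card_served k B i (A : {set 'I_m}) : 0 < k -> 0 < B -> m <= B ^ k.+1 ->
  F i A -> #|A| <= 3 * k * B * #|held k i| + #|A :&: taken k|.
Proof.
move=> k0 B0 mB FA; set c := #|held k i|.
have cardA (s : 'I_m) q : #|universe k i s| <= q ->
    #|A| <= k * s + q + #|A :&: taken k|.
  move=> le; apply: leq_trans (_ : #|A :\: (universe k i s :|: taken k)|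
      + #|universe k i s| + #|A :&: taken k| <= _); last first.
    by rewrite !leq_add2r (leq_add (card_lost k s FA)).
  apply: leq_trans (leq_add (leq_card_setU _ _) (leqnn _)).
  apply: leq_trans (leq_card_setU _ _).
  apply: subset_leq_card; apply/subsetP => x; rewrite !inE => ->.
  by case: (x \in universe k i s); case: (x \in taken k).
have Am : #|A| <= m by rewrite -[X in _ <= X](card_ord m) max_card.
have [m0|m0] := posnP m; first by lia.
(* A player who ends with nothing is treated at bundle size 1: nothing is lost there, and any
   shrinking factor is allowed, so [m.+1] empties the universe. *)
have [c0|c0] := posnP c.
  have U0 : #|universe k i (Ordinal m0)| <= 0.
    have := @card_universe k k i (Ordinal m0) m.+1 (leqnn _).
    rewrite -/c c0 => /(_ isT) le.
    have : m.+1 ^ 1 <= m.+1 ^ k by rewrite leq_pexp2l.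
    by rewrite expn1; move: le; case: #|_| => // u; nia.
  by apply: leq_trans (cardA _ _ U0) _ => /=; lia.
(* The bundle size is [2 * c * B], with index one less. If it exceeds [m], the bound is trivial
   because [#|A| <= m]. *)
have [le|gt] := leqP (2 * c * B) m; last by nia.
have ltm : (2 * c * B).-1 < m by nia.
have cB : 0 < 2 * c * B by nia.
have := @card_universe k k i (Ordinal ltm) B (leqnn _).
rewrite /= prednK // => /(_ (leqnn _)) le'.
have UB : #|universe k i (Ordinal ltm)| <= B.
  rewrite -(@leq_pmul2r (B ^ k)) ?expn_gt0 ?B0 //.
  by apply: leq_trans le' _; rewrite -expnS.
apply: leq_trans (cardA _ _ UB) _ => /=.
rewrite leq_add2r; nia.
Qed.

(** Double counting: an item lies in at most one bundle. *)
Lemma sum_card_setI (A : bundles m n) (H : {set 'I_m}) : is_allocation A ->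
  \sum_i #|A i :&: H| <= #|H|.
Proof.
move=> allA.
rewrite (eq_bigr (fun i => \sum_(x in H) (x \in A i))); last first.
  move=> i _; rewrite -sum1_card [RHS]big_mkcond [LHS]big_mkcond /=.
  by apply: eq_bigr => x _; rewrite inE; case: (x \in A i); case: (x \in H).
rewrite exchange_big -sum1_card; apply: leq_sum => x _ /=.
have [/existsP[i xi]|/existsPn no] := boolP [exists i, x \in A i]; last first.
  by rewrite big1 // => i _; rewrite (negPf (no i)).
rewrite (bigD1 i) //= xi big1 ?addn0 // => j ji.
have /forallP/(_ j)/forallP/(_ i)/implyP/(_ ji)/pred0P/(_ x) /= := allA.
by rewrite xi andbT => ->.
Qed.

Theorem volume_held k B (A : bundles m n) : 0 < k -> 0 < B -> m <= B ^ k.+1 ->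
  is_allocation A -> (forall i, F i (A i)) ->
  volume A <= 5 * k * B * volume (after k).1.1.
Proof.
move=> k0 B0 mB allA FA.
have /and3P[_ _ cH] := after_balanced k.
apply: leq_trans
  (_ : \sum_i (3 * k * B * #|held k i| + #|A i :&: taken k|) <= _).
  by apply: leq_sum => i _; exact: card_served.
rewrite big_split /= -big_distrr /=.
apply: leq_trans (leq_add (leqnn _) (leq_trans (sum_card_setI _ allA) cH)) _.
change (3 * k * B * volume (after k).1.1 + 2 * volume (after k).1.1 <=
  5 * k * B * volume (after k).1.1).
move: (volume _) => w.
(* This absorbs the taken items, whence the constant 3 + 2 = 5. *)
have : w <= k * B * w by rewrite leq_pmull // muln_gt0 k0.
by nia.
Qed.

End Greedy.

(** * The blackboard algorithm *)

Section Encoding.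
Local Open Scope nat_scope.
Local Open Scope set_scope.
Variable m : nat.

(* A family of disjoint nonempty bundles of each size is encoded by the
   relation "belong to a common bundle of size s" on pairs of items. *)
Definition pixel := ('I_m * 'I_m * 'I_m)%type.

Definition together (D : 'I_m -> {set {set 'I_m}}) (x : pixel) : bool :=
  [exists b in D x.1.1, (x.1.2 \in b) && (x.2 \in b)].

Definition encode (L : nat) (D : nat -> 'I_m -> {set {set 'I_m}}) : seq bool :=
  mkseq (fun p => if insub (p %% #|{: pixel}|) is Some r
                  then together (D (p %/ #|{: pixel}|))
                         (enum_val (r : 'I_#|{: pixel}|))
                  else false)
        (L * #|{: pixel}|).

Definition decode (e : seq bool) (z : nat) (s : 'I_m) : {set {set 'I_m}} :=
  let g j j' := nth false e (z * #|{: pixel}| + enum_rank ((s, j, j') : pixel))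
  in [set [set j' | g j j'] | j in [set j | g j j]].

Lemma size_encode L D : size (encode L D) = L * #|{: pixel}|.
Proof. exact: size_mkseq. Qed.

(** Beyond the end of a message every bit reads [false], that is, as an empty family; a reader need
    not know the [L] of the writer. *)
Lemma nth_encode L D z (x : pixel) : (forall s, L <= z -> D z s = set0) ->
  nth false (encode L D) (z * #|{: pixel}| + enum_rank x) = together (D z) x.
Proof.
move=> D0; have rN := ltn_ord (enum_rank x).
have N0 : 0 < #|{: pixel}| by apply: leq_ltn_trans rN.
have [zL|Lz] := ltnP z L; last first.
  rewrite nth_default; last first.
    rewrite size_encode (leq_trans _ (leq_addr _ _)) //.
    by rewrite leq_mul2r Lz orbT.
  apply/esym/negbTE/existsPn => b.
  by rewrite D0 // inE.
rewrite nth_mkseq; last first.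
  apply: (@leq_trans (z.+1 * #|{: pixel}|)); last by rewrite leq_mul2r zL orbT.
  by rewrite mulSn addnC ltn_add2r.
rewrite modnMDl modn_small // divnMDl // divn_small // addn0.
by rewrite valK enum_rankK.
Qed.

(** By disjointness, the items together with a covered [j] form the one bundle containing [j];
    nonempty bundles all arise in this way. *)
Lemma encodeK L D z : (forall s, L <= z -> D z s = set0) ->
  (forall s, trivIset (D z s)) -> (forall s, set0 \notin D z s) ->
  decode (encode L D) z = D z.
Proof.
move=> D0 triv non0; apply/funext => s; rewrite /decode.
have tog b j j' : b \in D z s -> j \in b ->
    together (D z) ((s, j, j') : pixel) = (j' \in b).
  move=> bD jb; apply/existsP/idP => /=.
    case=> c /and3P[cD jc j'c]; suff <- : c = b by [].
    apply/eqP/negPn/negP => cb.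
    have /trivIsetP/(_ c b cD bD cb)/pred0P/(_ j) /= := triv s.
    by rewrite jc jb.
  by move=> j'b; exists b; rewrite bD jb.
have row b j : b \in D z s -> j \in b -> [set j' |
    nth false (encode L D)
      (z * #|{: pixel}| + enum_rank ((s, j, j') : pixel))] = b.
  by move=> bD jb; apply/setP => j'; rewrite inE nth_encode // (tog b).
apply/setP => b; apply/imsetP/idP.
  case=> j; rewrite inE nth_encode // => /existsP[c /and3P[cD jc _]] ->.
  by rewrite (row c).
move=> bD; have /set0Pn[j jb] : b != set0.
  by apply: contraNneq (non0 s) => <-.
exists j; last by rewrite (row b).
by rewrite inE nth_encode // (tog b).
Qed.

End Encoding.

Definition argmax (R : realType) (N : nat) (g : nat -> R) : 'I_N.+1 :=
  [arg max_(z > ord0) g z]%O.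

Lemma argmax_max (R : realType) N (g : nat -> R) (z : 'I_N.+1) :
  g z <= g (argmax N g).
Proof. by rewrite /argmax; case: arg_maxP; [|move=> b _ h; exact: h]. Qed.

(** * All density levels in parallel *)

Section Parallel.
Variables (R : realType) (m n : nat).
Local Open Scope set_scope.

Definition dense_bundle (mu : R) (v : valuation R m) (b : {set 'I_m}) : bool :=
  [forall T : {set 'I_m}, (T \subset b) ==> (mu * #|T|%:R <= v T)].

Lemma dense_bundle_sub mu v (b c : {set 'I_m}) :
  dense_bundle mu v b -> c \subset b -> dense_bundle mu v c.
Proof.
move=> /forallP h cb; apply/forallP => T; apply/implyP => Tc.
by have /implyP := h T; apply; exact: subset_trans cb.
Qed.

Lemma dense_bundle_le mu v b : dense_bundle mu v b -> mu * #|b|%:R <= v b.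
Proof. by move=> /forallP/(_ b)/implyP; apply. Qed.

Lemma dense_bundle0 mu v : v set0 = 0 -> dense_bundle mu v set0.
Proof.
move=> v0; apply/forallP => T; apply/implyP; rewrite subset0 => /eqP ->.
by rewrite cards0 mulr0 v0.
Qed.

(* The natural numbers enumerate all integral powers of 2. *)
Definition level (z : nat) : R :=
  if odd z then 2%:R ^- z./2 else 2%:R ^+ z./2.

Lemma level_gt0 z : 0 < level z.
Proof. by rewrite /level; case: odd; rewrite ?invr_gt0 exprn_gt0. Qed.

(* Player [i] takes part in the levels below [L (v i)] only, which keeps the
   messages finite. *)
Variable L : valuation R m -> nat.

Definition target (v : valuation R m) (z : nat) (b : {set 'I_m}) : bool :=
  dense_bundle (level z) v b && ((b == set0) || (z < L v)%N).

(** The messages alone determine the holdings and universes, so anyone can replay the process. *)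
Definition reached (h : blackboard n) (z : nat) : state m n :=
  foldl (fun (st : state m n) (e : {ffun 'I_n -> seq bool}) =>
           advance st (fun i => decode (e i) z)) (start m n) h.

Definition gain (h : blackboard n) (z : nat) : R :=
  level z * (volume (reached h z).1.1)%:R.

(** The total message length can be read off the blackboard and bounds every active level once there
    are items and rounds. *)
Definition best (h : blackboard n) :=
  argmax (\sum_(e <- h) \sum_i size (e i))%N (gain h).

Definition parallel_greedy : algorithm R m n :=
  {| message := fun i v h => encode (L v)
       (fun z s => max_packing (target v z) ((reached h z).2 i s) s.+1);
     output := fun h => (reached h (best h)).1.1 |}.

Lemma target_sub v z (b c : {set 'I_m}) :
  target v z b -> c \subset b -> target v z c.
Proof.
move=> /andP[db act] cb; rewrite /target (dense_bundle_sub db cb) /=.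
have [//|] := eqVneq c set0.
case/orP: act => [/eqP b0|-> //].
by move: cb; rewrite b0 subset0 => /eqP ->; rewrite eqxx.
Qed.

Variable v : profile R m n.

Definition targets z i := target (v i) z.

Lemma reached_run r z :
  reached (run parallel_greedy v r) z = after (targets z) r.
Proof.
elim: r => // r IH; rewrite /reached /= -cats1 foldl_cat /= -/(reached _ z) IH.
congr advance; apply/funext => i; rewrite ffunE encodeK.
- by apply/funext => s; rewrite IH.
- move=> s Lz; apply/eqP/set0Pn => -[b bP].
  have [_ cb] := packing_mem (max_packingP _ _ _) bP.
  rewrite /target ltnNge Lz orbF => /andP[_ /eqP b0].
  by rewrite b0 cards0 in cb.
- by move=> s; have /andP[] := max_packingP (target (v i) z)
    ((reached (run parallel_greedy v r) z).2 i s) s.+1.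
- move=> s; apply/negP => bP.
  by have [_ ] := packing_mem (max_packingP _ _ _) bP; rewrite cards0.
Qed.

Lemma bits_sent_parallel k i : bits_sent parallel_greedy v k i =
  (k * (L (v i) * #|{: pixel m}|))%N.
Proof.
rewrite /bits_sent; elim: k => [|k IH]; first by rewrite big_nil.
rewrite /= -cats1 big_cat /= big_seq1 ffunE size_encode.
by rewrite [X in (X + _)%N]IH mulSnr.
Qed.

Hypothesis v0 : forall i, v i set0 = 0.

Lemma output_allocation k :
  is_allocation (output parallel_greedy (run parallel_greedy v k)).
Proof.
rewrite /=; set z := nat_of_ord _; rewrite reached_run.
by have /and3P[] := after_balanced (targets z) k.
Qed.

Lemma gain_best k :
  gain (run parallel_greedy v k) (best (run parallel_greedy v k)) <=
  welfare v (output parallel_greedy (run parallel_greedy v k)).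
Proof.
rewrite /gain /welfare /=; set z := best _; rewrite reached_run.
rewrite /volume natr_sum mulr_sumr; apply: ler_sum => i _.
apply: dense_bundle_le.
suff /andP[] : target (v i) z ((after (targets z) k).1.1 i) by [].
apply: (@heldF m n (targets z)); last by move=> j; exact: target_sub.
by move=> j; rewrite /targets /target dense_bundle0 // eqxx.
Qed.

Lemma welfare_output_ge0 k :
  0 <= welfare v (output parallel_greedy (run parallel_greedy v k)).
Proof.
by apply: le_trans (gain_best k); rewrite mulr_ge0 // ltW // level_gt0.
Qed.

Theorem parallel_greedyP k B z (A : bundles m n) :
  (0 < k)%N -> (0 < B)%N -> (m <= B ^ k.+1)%N -> is_allocation A ->
  (forall i, dense_bundle (level z) (v i) (A i)) ->
  (forall i, A i != set0 -> (z < L (v i))%N) ->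
  level z * (volume A)%:R <= (5 * k * B)%:R *
    welfare v (output parallel_greedy (run parallel_greedy v k)).
Proof.
move=> k0 B0 mB allA dA actA.
(* A nonempty bundle is needed to know that level [z] is active for some player, hence inspected by
   [best]. *)
have [->|volA] := eqVneq (volume A) 0%N.
  by rewrite mulr0 mulr_ge0 // welfare_output_ge0.
have [i Ai] : exists i, A i != set0.
  apply/existsP; apply: contraNT volA => /existsPn A0.
  apply/eqP/big1 => i _; have := A0 i; rewrite negbK => /eqP ->.
  exact: cards0.
set h := run _ v k.
have zh : (z < (\sum_(e <- h) \sum_i size (e i))%N.+1)%N.
  rewrite ltnS exchange_big /= (bigD1 i) //=; apply: leq_trans (leq_addr _ _).
  rewrite -/(bits_sent parallel_greedy v k i) bits_sent_parallel.
  have /set0Pn[j _] := Ai.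
  have : (0 < #|{: pixel m}|)%N by apply/card_gt0P; exists ((j, j), j).
  move=> N0; apply: leq_trans (leq_pmull _ k0).
  exact: leq_trans (ltnW (actA i Ai)) (leq_pmulr _ N0).
have le : level z * (volume A)%:R <= (5 * k * B)%:R * gain h z.
  rewrite /gain mulrCA ler_pM2l ?level_gt0 // -natrM ler_nat /h reached_run.
  apply: volume_held => // j; first by move=> b c; exact: target_sub.
  rewrite /targets /target dA /=.
  by have [//|/actA ->] := eqVneq (A j) set0.
apply: le_trans le _; apply: ler_wpM2l; first exact: ler0n.
apply: le_trans (gain_best k); rewrite -/h.
exact: (argmax_max (gain h) (Ordinal zh)).
Qed.

End Parallel.

(** * Density levels and logarithms *)

Section Numerics.
Variable R : realType.

Lemma ln2_gt0 : 0 < ln (2%:R : R).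
Proof. by rewrite ln_gt0 // ltr1n. Qed.

Lemma exp2_le_log2 (k m : nat) : (0 < k)%N -> k%:R <= log2 (m%:R : R) ->
  (2 ^ k <= m)%N.
Proof.
move=> k0; rewrite /log2 ler_pdivlMr ?ln2_gt0 // => le.
(* [ln] is 0 at 0, which contradicts the positive lower bound. *)
have m0 : (0 < m)%N.
  case: m le => // le.
  have : 0 < k%:R * ln (2%:R : R) by rewrite mulr_gt0 ?ln2_gt0 ?ltr0n.
  by rewrite ltNge (le_trans le) // ln0.
rewrite -(ler_nat R) natrX -ler_ln ?posrE ?exprn_gt0 ?ltr0n //.
by rewrite lnXn ?ltr0n // -[leLHS]mulr_natl.
Qed.

Lemma log2_ge (e m : nat) : (2 ^ e <= m)%N -> e%:R <= log2 (m%:R : R).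
Proof.
move=> le; rewrite /log2 ler_pdivlMr ?ln2_gt0 //.
rewrite mulr_natl -lnXn ?ltr0n // ler_ln ?posrE ?exprn_gt0 ?ltr0n //.
  by rewrite -natrX ler_nat.
by apply: leq_trans le; rewrite expn_gt0.
Qed.

(** The least possible [B] exceeds the real root by at most 1, and the root is at least 1. *)
Lemma root_ceil (k m : nat) : (0 < m)%N ->
  exists B : nat, [/\ (0 < B)%N, (m <= B ^ k.+1)%N
    & B%:R <= 2%:R * (m%:R : R) `^ (k.+1%:R)^-1].
Proof.
move=> m0.
have exB : exists B, (m <= B ^ k.+1)%N.
  by exists m; rewrite expnS leq_pmulr // expn_gt0 m0.
case: (ex_minnP exB) => -[|B] mB minB.
  by move: mB; rewrite exp0n // leqNgt m0.
exists B.+1; split => //.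
have root1 : 1 <= (m%:R : R) `^ (k.+1%:R)^-1.
  by rewrite -[leLHS](powRr0 m%:R) ler_powR ?ler1n // invr_ge0.
suff le : B%:R <= (m%:R : R) `^ (k.+1%:R)^-1.
  by rewrite -addn1 natrD; lra.
have lt : (B ^ k.+1 <= m)%N.
  by rewrite leqNgt; apply/negP => /ltnW /minB; rewrite ltnn.
have -> : B%:R = (B%:R ^+ k.+1 : R) `^ (k.+1%:R)^-1.
  by rewrite -powR_mulrn // -powRrM divff ?pnatr_eq0 // powRr1.
by rewrite ge0_ler_powR ?nnegrE ?invr_ge0 ?exprn_ge0 // -natrX ler_nat.
Qed.

Lemma level_even e : level R e.*2 = 2%:R ^+ e.
Proof. by rewrite /level odd_double doubleK. Qed.

Lemma level_odd e : level R e.*2.+1 = 2%:R ^- e.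
Proof. by rewrite /level /= odd_double /= uphalf_double. Qed.

Lemma level_double z : exists z', level R z' = 2%:R * level R z.
Proof.
have [zo|ze] := boolP (odd z); last first.
  exists z./2.+1.*2; rewrite level_even exprS.
  by rewrite [in RHS]/level (negbTE ze).
rewrite {2}/level zo.
(* Code 1 also stands for the density 1, whose double has an even code. *)
case: (z./2) => [|e].
  by exists 2%N; rewrite (level_even 1) expr0 invr1 mulr1.
exists e.*2.+1; rewrite level_odd exprS invfM mulrA divff ?mul1r ?pnatr_eq0 //.
Qed.

Lemma level_pow z l : exists z', level R z' = 2%:R ^+ l * level R z.
Proof.
elim: l => [|l [z' IH]]; first by exists z; rewrite mul1r.
by have [z'' e] := level_double z'; exists z''; rewrite e IH exprS mulrA.
Qed.

Lemma pow2_unbounded (x : R) : exists e : nat, x < 2%:R ^+ e.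
Proof.
by exists (Num.bound x); exact: upper_nthrootP.
Qed.

Lemma level_between (x : R) : 0 < x ->
  exists2 z, level R z <= x & x < 2%:R * level R z.
Proof.
move=> x0; have [x1|x1] := leP 1 x.
  case: (ex_minnP (pow2_unbounded x)) => -[|e] lt mine.
    by move: lt; rewrite ltNge x1.
  exists e.*2; rewrite level_even -?exprS //.
  by rewrite leNgt; apply/negP => /mine; rewrite ltnn.
have [e0 lt0] := pow2_unbounded x^-1.
have exe : exists e, 2%:R ^- e <= x.
  by exists e0; rewrite invf_ple ?posrE ?exprn_gt0 ?ltr0n // ltW.
case: (ex_minnP exe) => -[|e] le mine.
  by move: le; rewrite expr0 invr1 leNgt x1.
exists e.+1.*2.+1; rewrite level_odd // exprS invfM mulrA divff ?pnatr_eq0 //.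
by rewrite mul1r ltNge; apply/negP => /mine; rewrite ltnn.
Qed.

Lemma level_code e z : 2%:R ^- e <= level R z <= 2%:R ^+ e ->
  (z <= e.*2.+1)%N.
Proof.
have two1 : 1 < 2%:R :> R by rewrite ltr1n.
rewrite /level; have := odd_double_half z.
case: (odd z) => /= eqz /andP[lo hi].
  rewrite lef_pV2 ?posrE ?exprn_gt0 ?ltr0n // ler_eXn2l // in lo.
  by rewrite -eqz add1n ltnS leq_double.
by rewrite ler_eXn2l // in hi; rewrite -eqz add0n ltnW // ltnS leq_double.
Qed.

End Numerics.

(** * Dense bundles of binary XOS and subadditive valuations *)

Section Valuations.
Local Open Scope set_scope.
Variables (R : realType) (m : nat).
Implicit Types (v : valuation R m) (S X : {set 'I_m}) (mu : R).

Lemma valuation_ge0 v S : is_valuation v -> 0 <= v S.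
Proof. by case=> v0 mono; rewrite -v0; apply: mono; exact: sub0set. Qed.

(** [X] consists of the items of [S] with value 1 in a clause attaining the maximum on [S]; the same
    clause bounds [v] from below on subsets of [X]. *)
Lemma binary_xos_support v S : binary_xos 1 v ->
  exists X, [/\ X \subset S, dense_bundle (level R 0) v X & v S = #|X|%:R].
Proof.
case=> q [a [[adda vE] bin]].
have a_ge0 r T : 0 <= a r T by apply: valuation_ge0; have [] := adda r.
have [r _ vS] := @eq_bigmax _ R _ 0 ord0 xpredT (fun r => a r S) isT
  (fun r _ => a_ge0 r S).
have av T : a r T <= v T by rewrite vE; exact: (le_bigmax 0 (fun r => a r T)).
exists [set j in S | a r [set j] == 1]; split.
- by apply/subsetP => j; rewrite inE => /andP[].
- apply/forallP => T; apply/implyP => /subsetP TX.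
  apply: le_trans (av T); have [_ ->] := adda r.
  rewrite /level expr0 mul1r -sumr_const; apply: ler_sum => j /TX.
  by rewrite inE => /andP[_ /eqP ->].
- rewrite vE vS; have [_ ->] := adda r.
  rewrite -sumr_const [RHS]big_mkcond [LHS]big_mkcond /=.
  apply: eq_bigr => j _; rewrite inE; case: (j \in S) => //=.
  by have [->|->] := bin r j; rewrite ?eqxx // eq_sym oner_eq0.
Qed.

Lemma binary_xos0 v : binary_xos 1 v -> v set0 = 0.
Proof.
move=> /(binary_xos_support set0)[X [X0 _ ->]].
by move: X0; rewrite subset0 => /eqP ->; rewrite cards0.
Qed.

(* [S :\: X] is a largest subset of [S] of value at most [mu] per item. *)
Lemma peel v mu S : is_valuation v -> Defs.subadditive v ->
  exists X, [/\ X \subset S, dense_bundle mu v X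
    & v S <= mu * #|S :\: X|%:R + v X].
Proof.
move=> [v0 mono] sub.
pose bad (T : {set 'I_m}) := (T \subset S) && (v T <= mu * #|T|%:R).
have bad0 : bad set0 by rewrite /bad sub0set v0 cards0 mulr0 lexx.
have [T /andP[TS vT] maxT] : exists2 T, bad T &
    forall T', bad T' -> (#|T'| <= #|T|)%N.
  by case: (arg_maxnP (fun T : {set 'I_m} => #|T|) bad0) => T bT h; exists T.
exists (S :\: T); split; first exact: subsetDl.
  apply/forallP => Y; apply/implyP; rewrite subsetD => /andP[YS dYT].
  rewrite leNgt; apply/negP => vY.
  have cTY : #|T :|: Y| = (#|T| + #|Y|)%N.
    by rewrite cardsU disjoint_setI0 1?disjoint_sym // cards0 subn0.
  (* Subadditivity would let a violating [Y] enlarge the largest cheap subset [T]. *)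
  have /maxT : bad (T :|: Y).
    rewrite /bad subUset TS YS cTY natrD mulrDr /=.
    by apply: le_trans (sub _ _) _; rewrite lerD // ltW.
  rewrite cTY -[leqRHS]addn0 leq_add2l leqn0 cards_eq0 => /eqP Y0.
  by rewrite Y0 v0 cards0 mulr0 ltxx in vY.
have -> : S :\: (S :\: T) = T.
  by rewrite setDDr setDv set0U; apply/setIidPr.
apply: le_trans (_ : v (T :|: (S :\: T)) <= _).
  by rewrite -{1}(setIidPr TS) setID.
by apply: le_trans (sub _ _) _; rewrite lerD2r.
Qed.

Definition densest mu v S : {set 'I_m} :=
  [arg max_(X > set0 | (X \subset S) && dense_bundle mu v X) #|X|].

Lemma densestP mu v S : v set0 = 0 ->
  [/\ densest mu v S \subset S, dense_bundle mu v (densest mu v S)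
    & forall X, X \subset S -> dense_bundle mu v X ->
        (#|X| <= #|densest mu v S|)%N].
Proof.
move=> v0; rewrite /densest; case: arg_maxnP.
  by rewrite sub0set dense_bundle0.
by move=> X /andP[XS dX] maxX; split => // Y YS dY; apply: maxX; rewrite YS dY.
Qed.

(** What is peeled off at density [2 ^ l.+1 * mu] lies in a bundle dense at half that density, so
    [densest] bounds its size; this gives the factor 2. *)
Lemma layers v mu S l : 0 < mu -> is_valuation v -> Defs.subadditive v ->
  exists X, [/\ X \subset S, dense_bundle (2%:R ^+ l * mu) v X &
    v S <= mu * #|S|%:R + v X + 2%:R *
      \sum_(j < l) 2%:R ^+ j * mu * #|densest (2%:R ^+ j * mu) v S|%:R].
Proof.
move=> mu0 val sub; elim: l => [|l [X [XS dX vS]]].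
  have [X [XS dX vS]] := peel mu S val sub.
  exists X; rewrite expr0 mul1r big_ord0 mulr0 addr0; split => //.
  apply: le_trans vS _; rewrite lerD2r ler_pM2l // ler_nat.
  exact/subset_leq_card/subsetDl.
have [Y [YX dY vX]] := peel (2%:R ^+ l.+1 * mu) X val sub.
exists Y; split => //; first exact: subset_trans YX XS.
have [_ _ maxd] := densestP (2%:R ^+ l * mu) S (proj1 val).
rewrite big_ord_recr /=.
have le : 2%:R ^+ l.+1 * mu * #|X :\: Y|%:R <=
    2%:R * (2%:R ^+ l * mu * #|densest (2%:R ^+ l * mu) v S|%:R).
  rewrite !mulrA -exprS ler_pM2l ?mulr_gt0 ?exprn_gt0 ?ltr0n // ler_nat.
  apply: leq_trans (maxd X XS dX).
  exact/subset_leq_card/subsetDl.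
by move: vS vX le; rewrite mulrDr; lra.
Qed.

Definition magnitude v (b : nat) : bool :=
  [forall S : {set 'I_m}, (v S == 0) || (2%:R ^- b <= v S <= 2%:R ^+ b)].

Lemma magnitude_exists v : (forall S, 0 <= v S) -> exists b, magnitude v b.
Proof.
move=> v0.
have exb S : exists b : nat, (v S == 0) || (2%:R ^- b <= v S <= 2%:R ^+ b).
  have [_|nz] := eqVneq (v S) 0; first by exists 0%N.
  have [a lta] := pow2_unbounded (v S).
  have [c ltc] := pow2_unbounded (v S)^-1.
  exists (a + c)%N; rewrite /= exprD; apply/andP; split.
    rewrite invf_ple ?posrE ?mulr_gt0 ?exprn_gt0 ?ltr0n //; last first.
      by rewrite lt_def nz v0.
    apply: le_trans (ltW ltc) _; rewrite ler_peMl ?exprn_ge0 //.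
    by rewrite exprn_ege1 // ler1n.
  apply: le_trans (ltW lta) _; rewrite ler_peMr ?exprn_ge0 //.
  by rewrite exprn_ege1 // ler1n.
have [f fP] := choice exb.
exists (\max_(S : {set 'I_m}) f S)%N; apply/forallP => S.
have fle : (f S <= \max_(S : {set 'I_m}) f S)%N by exact: leq_bigmax.
have two1 : 1 < 2%:R :> R by rewrite ltr1n.
case/orP: (fP S) => [->//|/andP[lo hi]]; apply/orP; right.
apply/andP; split.
  apply: le_trans lo.
  by rewrite lef_pV2 ?posrE ?exprn_gt0 ?ltr0n // ler_eXn2l.
by apply: le_trans hi _; rewrite ler_eXn2l.
Qed.

(** Each player finds this number from his own valuation, so no common bound on magnitudes has to be
    known. *)
Definition order_of v : nat :=
  if pselect (exists b, magnitude v b) is left ex then ex_minn ex else 0%N.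

Lemma order_of_magnitude v : (forall S, 0 <= v S) -> magnitude v (order_of v).
Proof.
move=> /magnitude_exists ex; rewrite /order_of; case: pselect => // ex'.
by case: ex_minnP.
Qed.

Lemma order_of_min v b : magnitude v b -> (order_of v <= b)%N.
Proof.
move=> mb; rewrite /order_of; case: pselect => // ex.
by case: ex_minnP => c _; apply.
Qed.

End Valuations.

(** * Allocations and the optimum *)

Section Optimum.
Local Open Scope set_scope.
Variables (R : realType) (m n : nat) (v : profile R m n).

Lemma OPT_le (c : R) : 0 <= c ->
  (forall A, is_allocation A -> welfare v A <= c) -> OPT v <= c.
Proof. by move=> c0 h; apply: bigmax_le. Qed.

Lemma OPT_ge0 : 0 <= OPT v.
Proof. exact: bigmax_ge_id. Qed.

Lemma sub_allocation (A C : bundles m n) : is_allocation A ->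
  (forall i, C i \subset A i) -> is_allocation C.
Proof.
move=> /forallP allA CA; apply/forallP => i; apply/forallP => j.
apply/implyP => ij; have /forallP/(_ j)/implyP/(_ ij) := allA i.
by move=> dA; apply: disjointWl (CA i) _; apply: disjointWr (CA j) _.
Qed.

Lemma volume_le (A : bundles m n) : is_allocation A -> (volume A <= m)%N.
Proof.
move=> allA; rewrite -[leqRHS](card_ord m) -cardsT.
rewrite /volume (eq_bigr (fun i => #|A i :&: setT|)); last first.
  by move=> i _; rewrite setIT.
exact: sum_card_setI.
Qed.

End Optimum.

(** * Approximation ratios *)

Section BinaryXOS.
Variables (R : realType) (m n : nat) (v : profile R m n).
Hypothesis bin : forall i, binary_xos 1 (v i).
Local Notation P := (parallel_greedy n (fun _ : valuation R m => 1%N)).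

(** Cutting the bundles of an allocation down to their supports keeps its welfare and makes them
    dense at density 1, which is level 0. *)
Lemma binary_xos_welfare k B : (0 < k)%N -> (0 < B)%N -> (m <= B ^ k.+1)%N ->
  OPT v <= (5 * k * B)%:R * welfare v (output P (run P v k)).
Proof.
move=> k0 B0 mB; have v0 i := binary_xos0 (bin i).
apply: OPT_le; first by rewrite mulr_ge0 // welfare_output_ge0.
move=> O allO.
have [A hA] := choice (fun i => binary_xos_support (O i) (bin i)).
have allA : is_allocation [ffun i => A i].
  by apply: sub_allocation allO _ => i; rewrite ffunE; have [] := hA i.
have := parallel_greedyP v0 (L := fun=> 1%N) (z := 0%N) k0 B0 mB allA.
have -> : level R 0 * (volume [ffun i => A i])%:R = welfare v O.
  rewrite /level expr0 mul1r /volume natr_sum; apply: eq_bigr => i _.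
  by rewrite ffunE; have [_ _ ->] := hA i.
apply=> [i|//]; rewrite ffunE.
by have [] := hA i.
Qed.

End BinaryXOS.

(* Only densities from OPT / 4m on matter; they are at least
   [2 ^- (order_of v + m + 2)], and [depth] bounds the codes of such levels. *)
Definition depth (R : realType) (m : nat) (v : valuation R m) : nat :=
  (order_of v + m + 2).*2.+2.

Section Subadditive.
Variables (R : realType) (m n : nat) (v : profile R m n).
Hypothesis inst : subadditive_instance v.
Local Notation Q := (parallel_greedy n (@depth R m)).

(** The density is at most the value of [A] and at least that value divided by [4 * m]; [order_of]
    bounds the value on both sides. *)
Lemma active_level i (mu : R) z (A O : {set 'I_m}) :
  (0 < m)%N -> A \subset O -> A != finset.set0 ->
  level R z * #|A|%:R <= v i A -> v i O <= (4 * m)%:R * level R z ->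
  (z < depth (v i))%N.
Proof.
move=> m0 AO A0 dA vO; have [val _] := inst i.
have A1 : 1 <= #|A|%:R :> R by rewrite ler1n card_gt0.
have lz := level_gt0 R z.
have lev : level R z <= v i A.
  by apply: le_trans dA; rewrite ler_peMr // ltW.
have vA0 : 0 < v i A by apply: lt_le_trans lev.
have vAO : v i A <= v i O by have [_] := val; apply.
have /forallP/(_ A) := order_of_magnitude (fun S => valuation_ge0 S val).
rewrite gt_eqF //= => /andP[lo hi].
set b := order_of _ in lo hi.
have e0 (e : nat) : 0 < 2%:R ^+ e :> R by rewrite exprn_gt0 // ltr0n.
suff : (z <= (b + m + 2).*2.+1)%N by rewrite /depth -/b.
apply: (@level_code R); apply/andP; split; last first.
  apply: le_trans (le_trans lev hi) _.
  by rewrite ler_weXn2l ?ler1n // -addnA leq_addr.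
have m4 : (4 * m)%:R <= 2%:R ^+ (m + 2) :> R.
  by rewrite -natrX ler_nat expnD mulnC leq_mul2r /= ltnW // ltn_expl.
have : 2%:R ^- b <= 2%:R ^+ (m + 2) * level R z :> R.
  apply: le_trans lo (le_trans vAO (le_trans vO _)).
  by rewrite ler_pM2r.
rewrite -addnA [in X in _ -> X]exprD invfM => le.
by rewrite -(ler_pM2l (e0 (m + 2)%N)) mulrCA divff ?mulr1 // gt_eqF.
Qed.

Lemma subadditive_welfare k B : (1 < m)%N ->
  (0 < k)%N -> (0 < B)%N -> (m <= B ^ k.+1)%N ->
  OPT v <= 4%:R * (trunc_log 2 m + 3)%:R *
    ((5 * k * B)%:R * welfare v (output Q (run Q v k))).
Proof.
move=> m1 k0 B0 mB; have m0 := ltnW m1.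
have v0 i : v i finset.set0 = 0 by have [[]] := inst i.
set W := _%:R * welfare _ _.
have W0 : 0 <= W by rewrite mulr_ge0 // welfare_output_ge0.
set l := (trunc_log 2 m + 3)%N.
have c0 : 0 <= 4%:R * l%:R * W by rewrite mulr_ge0.
apply: OPT_le => //.
move=> O allO; set x := welfare v O.
have [x0|x0] := leP x 0; first exact: le_trans x0 c0.
have vO i : v i (O i) <= x.
  rewrite /x /welfare (bigD1 i) //= lerDl; apply: sumr_ge0 => j _.
  by apply: valuation_ge0; have [] := inst j.
have mR : 0 < m%:R :> R by rewrite ltr0n.
(* At this base density all items together account for at most half of [x], which is absorbed at the
   end; this turns the factor 2 of [layers] into 4. *)
have [|z0] := @level_between R (x / (2 * m)%:R).
  by rewrite divr_gt0 // ltr0n muln_gt0.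
rewrite ler_pdivlMr ?ltr0n ?muln_gt0 // ltr_pdivrMr ?ltr0n ?muln_gt0 //.
rewrite natrM; set mu := level R z0 => lo hi.
have mu0 : 0 < mu by exact: level_gt0.
have m4 : (4 * m)%:R <= 2%:R ^+ l :> R.
  rewrite -natrX ler_nat /l addnS addn2 expnS (expnS _ _.+1) mulnA leq_mul2l /=.
  by rewrite ltnW // trunc_log_ltn.
have player i : v i (O i) <= mu * #|O i|%:R + 2%:R *
    \sum_(j < l) 2%:R ^+ j * mu * #|densest (2%:R ^+ j * mu) (v i) (O i)|%:R.
  have [val sub] := inst i.
  have [X [XO dX vX]] := layers (O i) l mu0 val sub.
  (* After [l] doublings the density is at least [4 * m * mu], which exceeds [x]; a nonempty
     remainder would be worth more than the whole allocation. *)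
  have [X0|X0] := eqVneq X finset.set0; first by rewrite X0 v0 addr0 in vX.
  have := dense_bundle_le dX; have := (proj2 val) _ _ XO; have := vO i.
  have : 2%:R ^+ l * mu <= 2%:R ^+ l * mu * #|X|%:R.
    by rewrite ler_peMr ?ler1n ?card_gt0 // mulr_ge0 ?exprn_ge0 // ltW.
  have : (4 * m)%:R * mu <= 2%:R ^+ l * mu by rewrite ler_pM2r.
  by rewrite natrM; lra.
(* The densest bundles of one density form an allocation that the run at that level competes
   with. *)
have layer (j : 'I_l) : 2%:R ^+ j * mu *
    \sum_i #|densest (2%:R ^+ j * mu) (v i) (O i)|%:R <= W.
  have [z zE] := level_pow R z0 j; rewrite -/mu in zE.
  pose A : bundles m n := [ffun i => densest (2%:R ^+ j * mu) (v i) (O i)].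
  have AP i : A i \subset O i /\ dense_bundle (2%:R ^+ j * mu) (v i) (A i).
    by rewrite ffunE; have [] := densestP (2%:R ^+ j * mu) (O i) (v0 i).
  have -> : 2%:R ^+ j * mu * \sum_i #|densest (2%:R ^+ j * mu) (v i) (O i)|%:R
      = level R z * (volume A)%:R.
    rewrite zE /volume natr_sum; congr (_ * _).
    by apply: eq_bigr => i _; rewrite ffunE.
  apply: parallel_greedyP => //.
  - by apply: sub_allocation allO _ => i; have [] := AP i.
  - by move=> i; rewrite zE; have [] := AP i.
  - move=> i Ai; have [AO dA] := AP i.
    apply: active_level AO Ai _ _ => //; first by rewrite zE dense_bundle_le.
    apply: le_trans (vO i) _; rewrite zE natrM.
    have : mu <= 2%:R ^+ j * mu by rewrite ler_peMl ?exprn_ege1 ?ler1n // ltW.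
    move=> le; have : m%:R * mu <= m%:R * (2%:R ^+ j * mu) by rewrite ler_pM2l.
    by lra.
have : x <= mu * (volume O)%:R + 2%:R * (l%:R * W).
  have -> : l%:R * W = \sum_(j < l) W.
    by rewrite sumr_const card_ord mulr_natl.
  apply: le_trans (ler_sum _ (fun i _ => player i)) _.
  rewrite big_split /= -mulr_sumr -natr_sum lerD2l -mulr_sumr ler_pM2l //.
  rewrite exchange_big /=; apply: ler_sum => j _.
  by rewrite -mulr_sumr.
have : mu * (volume O)%:R <= mu * m%:R by rewrite ler_pM2l // ler_nat volume_le.
by lra.
Qed.

End Subadditive.

(** * Communication bounds and final ratios *)

Lemma approximates_by (R : realType) (m n k : nat) (P : algorithm R m n)
    (I : profile R m n -> Prop) (c : R) : 0 < c ->
  (forall v, I v -> is_allocation (output P (run P v k)) /\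
     OPT v <= c * welfare v (output P (run P v k))) ->
  approximates P k I c.
Proof.
move=> c0 h v /h[all le]; split => //.
by rewrite ler_pdivrMr // mulrC.
Qed.

Lemma card_pixel m : #|{: pixel m}| = (m ^ 3)%N.
Proof. by rewrite !card_prod !card_ord !expnS expn0 muln1 mulnA. Qed.

Lemma rounds_lt (R : realType) (m k : nat) :
  (0 < k)%N -> k%:R <= log2 (m%:R : R) -> (k < m)%N.
Proof.
by move=> k0 /(exp2_le_log2 k0); apply: leq_trans; exact: ltn_expl.
Qed.

Lemma ratio_le (R : realType) (m k B : nat) (r w : R) :
  B%:R <= 2%:R * r -> 0 <= w ->
  (5 * k * B)%:R * w <= 10%:R * (k%:R * r) * w.
Proof.
move=> Br w0; rewrite ler_wpM2r //.
have : k%:R * B%:R <= k%:R * (2%:R * r) by rewrite ler_wpM2l.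
by rewrite !natrM; lra.
Qed.

(** The root is the exponential of [ln m / (k + 1)], and [k] is at least [a * ln m / ln 2]. *)
Lemma root_le_const (R : realType) (m k : nat) (a : R) : 0 < a -> (1 < m)%N ->
  a * log2 m%:R <= k%:R ->
  m%:R `^ (k.+1%:R)^-1 <= expR (ln 2%:R / a).
Proof.
move=> a0 m1 le; have m0 : 0 < m%:R :> R by rewrite ltr0n ltnW.
rewrite -[leLHS]lnK ?posrE ?powR_gt0 // ler_expR ln_powR.
rewrite ler_pdivlMr // -mulrA mulrC ler_pdivrMr ?ltr0n //.
move: le; rewrite /log2 mulrA ler_pdivrMr ?ln2_gt0 // [a * _]mulrC => le.
apply: le_trans le _; rewrite mulrC ler_pM2l ?ln2_gt0 //.
by rewrite ler_nat.
Qed.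

Theorem theorem6p17 (R : realType) :
  (exists P : forall m n k t : nat, algorithm R m n,
    [/\ exists c d : nat, forall m n k t : nat,
          (0 < k)%N -> k%:R <= log2 (m%:R : R) ->
          forall v : profile R m n, t_restricted t v ->
          forall i : 'I_n,
            (bits_sent (P m n k t) v k i <= c * (m + n) ^ d)%N,
        exists2 C : R, 0 < C & forall m n k t : nat,
          (0 < k)%N -> k%:R <= log2 (m%:R : R) ->
          approximates (P m n k t) k (@t_restricted R m n t)
            (C * (k%:R * m%:R `^ (k.+1%:R)^-1))
      & forall a : R, 0 < a ->
        exists2 C : R, 0 < C & forall m n k t : nat,
          (0 < k)%N -> a * log2 m%:R <= k%:R <= log2 (m%:R : R) ->
          approximates (P m n k t) k (@t_restricted R m n t)
            (C * log2 m%:R)])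
  /\
  (exists Q : forall m n k : nat, algorithm R m n,
    (exists c d : nat, forall m n k b : nat,
       (0 < k)%N -> k%:R <= log2 (m%:R : R) ->
       forall v : profile R m n, subadditive_instance v -> magnitude_le b v ->
       forall i : 'I_n,
         (bits_sent (Q m n k) v k i <= c * (m + n + b) ^ d)%N) /\
    (exists2 C : R, 0 < C & forall m n k : nat,
       (0 < k)%N -> k%:R <= log2 (m%:R : R) ->
       approximates (Q m n k) k (@subadditive_instance R m n)
         (C * (k%:R * m%:R `^ (k.+1%:R)^-1 * log2 m%:R ^+ 3)))).
Proof.
split.
  pose P (m n k t : nat) := parallel_greedy n (fun _ : valuation R m => 1%N).
  have approx m n k t : (0 < k)%N -> k%:R <= log2 (m%:R : R) ->
      approximates (P m n k t) k (@t_restricted R m n t)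
        (10%:R * (k%:R * m%:R `^ (k.+1%:R)^-1)).
    move=> k0 kl; have m0 : (0 < m)%N by apply: leq_ltn_trans (rounds_lt k0 kl).
    have [B [B0 mB Br]] := root_ceil R k m0.
    apply: approximates_by.
      by rewrite !mulr_gt0 ?powR_gt0 ?ltr0n.
    move=> v [bin _]; split; first exact: output_allocation.
    apply: le_trans (binary_xos_welfare bin k0 B0 mB) _.
    apply: ratio_le => //; apply: welfare_output_ge0 => i.
    exact: binary_xos0 (bin i).
  exists P; split.
  - exists 1%N, 4%N => m n k t k0 kl v _ i.
    rewrite bits_sent_parallel card_pixel !mul1n.
    apply: (@leq_trans (m ^ 4)); last by rewrite leq_exp2r // leq_addr.
    (* Since [k < m], the [k * m ^ 3] bits number at most [m ^ 4]. *)
    by rewrite expnS leq_mul2r ltnW ?orbT // (rounds_lt k0 kl).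
  - by exists 10%:R => // m n k t; exact: approx.
  - move=> a a0; exists (10%:R * expR (ln 2%:R / a)).
      by rewrite mulr_gt0 ?expR_gt0.
    move=> m n k t k0 /andP[ak kl] v inst.
    have m1 : (1 < m)%N by apply: leq_ltn_trans (rounds_lt k0 kl).
    have [all le] := approx m n k t k0 kl v inst; split => //.
    apply: le_trans le; rewrite ler_wpM2l ?OPT_ge0 //.
    have m0 : 0 < m%:R :> R by rewrite ltr0n ltnW.
    have log0 : 0 < log2 (m%:R : R) by apply: lt_le_trans kl; rewrite ltr0n.
    have root0 : 0 < m%:R `^ (k.+1%:R)^-1 :> R by exact: powR_gt0.
    have C0 : 0 < 10%:R * expR (ln 2%:R / a) by rewrite mulr_gt0 ?expR_gt0.
    rewrite lef_pV2 ?posrE; first last.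
    - by rewrite !mulr_gt0 ?ltr0n.
    - exact: mulr_gt0.
    rewrite -mulrA ler_pM2l // mulrC; apply: ler_pM => //.
    exact: root_le_const.
exists (fun m n _ => parallel_greedy n (@depth R m)); split.
  exists 8%N, 5%N => m n k b k0 kl v inst mag i.
  rewrite bits_sent_parallel card_pixel.
  have km := rounds_lt k0 kl.
  have db : (depth (v i) <= 8 * (m + n + b))%N.
    have : (order_of (v i) <= b)%N.
      apply: order_of_min; apply/forallP => S.
      by case: (mag i S) => [->|->]; rewrite ?eqxx ?orbT.
    rewrite /depth; lia.
  rewrite (expnS _ 4) [leqRHS]mulnA; apply: (@leq_trans (depth (v i) * m ^ 4)).
    by rewrite mulnCA leq_mul2l (expnS m) leq_mul2r ltnW ?orbT.
  by rewrite leq_mul // leq_exp2r // -addnA leq_addr.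
(* 160 = 16 * 10: the number of layers contributes 16 times a single logarithm, bounded by its cube,
   and 10 is 5 times the factor 2 lost in rounding the root. *)
exists 160%:R => // m n k k0 kl.
have m1 : (1 < m)%N by apply: leq_ltn_trans (rounds_lt k0 kl).
have m0 := ltnW m1.
have [B [B0 mB Br]] := root_ceil R k m0.
have log1 : 1 <= log2 (m%:R : R) by exact: (@log2_ge R 1 m m1).
have trl : (trunc_log 2 m)%:R <= log2 (m%:R : R) by exact/log2_ge/trunc_logP.
set r := m%:R `^ _ in Br *; have r0 : 0 < r by rewrite powR_gt0 // ltr0n.
set lg := log2 _ in log1 trl *; have lg0 : 0 < lg by apply: lt_le_trans log1.
have kr0 : 0 < k%:R * r by rewrite mulr_gt0 ?ltr0n.
apply: approximates_by; first by rewrite mulr_gt0 // mulr_gt0 // exprn_gt0.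
move=> v inst; split; first exact: output_allocation.
apply: le_trans (subadditive_welfare inst m1 k0 B0 mB) _.
set w := welfare _ _.
have w0 : 0 <= w by apply: welfare_output_ge0 => i; have [[]] := inst i.
have lgs : 4%:R * (trunc_log 2 m + 3)%:R <= 16%:R * lg ^+ 3.
  have : lg <= lg ^+ 3 by rewrite ler_eXnr.
  by rewrite natrD; lra.
apply: le_trans (_ : 16%:R * lg ^+ 3 * (10%:R * (k%:R * r) * w) <= _).
  by apply: ler_pM => //; rewrite ?mulr_ge0 // ratio_le.
by rewrite le_eqVlt; apply/orP; left; apply/eqP; ring.
Qed.
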